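(* Let $\Delta$ be a simplicial complex and let $\mathcal{B}$ be a $\Delta$-building set. A subset $N\subseteq\mathcal{B}$ is $\mathcal{B}$-nested if and only if both of the following conditions hold: (1) for every subset $N'\subseteq N$ with $|N'|\ge 2$ such that every pair of distinct sets in $N'$ is disjoint, the union $\bigcup N'$ is in $\Delta$ and is not in $\mathcal{B}$; (2) no two sets $S_1,S_2\in N$ have nontrivial intersection.
   Context: A simplicial complex $\Delta$ on a finite base set $\mathcal{S}$ is a family of subsets of $\mathcal{S}$ (faces), closed under taking subsets, such that $\{s\}\in\Delta$ for every $s\in\mathcal{S}$. Ordered by inclusion, $\Delta$ is a meet-semilattice with minimal element $\emptyset$; the join of a family of faces exists exactly when their union is a face, and then it is the union. A $\Delta$-building set is a set $\mathcal{B}$ of nonempty faces of $\Delta$ such that (i) $\{s\}\in\mathcal{B}$ for every $s\in\mathcal{S}$, and (ii) if $S_1,S_2\in\mathcal{B}$, $S_1\cap S_2\neq\emptyset$ and $S_1\cup S_2\in\Delta$, then $S_1\cup S_2\in\mathcal{B}$. (This is equivalent to $\mathcal{B}$ being a building set of the face semilattice of $\Delta$ in the sense of Feichtner–Kozlov.) A subset $N\subseteq\mathcal{B}$ is $\mathcal{B}$-nested if for every set $\{x_1,\dots,x_t\}\subseteq N$ of pairwise incomparable (under inclusion) elements with $t\ge 2$, the join $x_1\vee\cdots\vee x_t$ exists in $\Delta$ (i.e. $x_1\cup\cdots\cup x_t\in\Delta$) and does not belong to $\mathcal{B}$. Two sets $S_1,S_2$ have nontrivial intersection if $S_1\not\subseteq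 S_2$, $S_2\not\subseteq S_1$ and $S_1\cap S_2\neq\emptyset$. *)

(* Defs.v *)
From mathcomp Require Import all_boot.

Set Implicit Arguments.
Unset Strict Implicit.
Unset Printing Implicit Defensive.

Section NestedSets.
(* The finite base set of the complex is the whole finite type T. *)
Variable T : finType.
Implicit Types (Delta B N X : {set {set T}}) (S J : {set T}).

Definition simplicial_complex Delta : Prop :=
  (forall S1 S2, S2 \in Delta -> S1 \subset S2 -> S1 \in Delta) /\
  (forall s : T, [set s] \in Delta).

Definition building_set Delta B : Prop :=
  [/\ B \subset Delta,
      set0 \notin B,
      forall s : T, [set s] \in B
    & forall S1 S2, S1 \in B -> S2 \in B -> S1 :&: S2 != set0 ->
        S1 :|: S2 \in Delta -> S1 :|: S2 \in B].

(* J is the least upper bound of X in the face poset (Delta, \subset). *)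
Definition is_join Delta X J : Prop :=
  [/\ J \in Delta,
      forall S, S \in X -> S \subset J
    & forall J', J' \in Delta -> (forall S, S \in X -> S \subset J') ->
        J \subset J'].

Definition pairwise_incomparable X : Prop :=
  {in X &, forall S1 S2, S1 != S2 -> ~~ (S1 \subset S2) /\ ~~ (S2 \subset S1)}.

Definition pairwise_disjoint X : Prop :=
  {in X &, forall S1 S2, S1 != S2 -> [disjoint S1 & S2]}.

Definition nested Delta B N : Prop :=
  N \subset B /\
  forall X, X \subset N -> 1 < #|X| -> pairwise_incomparable X ->
    exists J, is_join Delta X J /\ J \notin B.

Definition nontrivial_intersection S1 S2 : Prop :=
  [/\ ~~ (S1 \subset S2), ~~ (S2 \subset S1) & S1 :&: S2 != set0].

(* [cover X] is the union of the members of X: joins are unions. *)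
Lemma is_joinE Delta X J : simplicial_complex Delta ->
  is_join Delta X J <-> cover X \in Delta /\ J = cover X.
Proof.
case=> Dsub _; split=> [[JD Jub Jmin] | [cD ->]].
  have cJ : cover X \subset J by apply/bigcupsP.
  have cD : cover X \in Delta by exact: Dsub cJ.
  split=> //; apply/eqP; rewrite eqEsubset cJ andbT.
  by apply: Jmin => // S SX; exact: bigcup_sup SX.
by split=> // [S SX | J' _ J'ub]; [exact: bigcup_sup SX | apply/bigcupsP].
Qed.

End NestedSets.

(* Main.v *)
(* A building set is closed under unions of meeting members, so two members of
   a nested set with nontrivial intersection would have their join in B.  Hence
   for subsets of N "incomparable" and "disjoint" mean the same thing. *)
Require Import Defs.
From mathcomp Require Import all_boot.

(** If [A] is contained in [C] and disjoint from it, then [A] equals the empty intersection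
    [A :&: C]; this is why [set0] must be kept out of [X]. *)
Lemma pairwise_disjoint_incomparable (T : finType) (X : {set {set T}}) :
  set0 \notin X -> pairwise_disjoint X -> pairwise_incomparable X.
Proof.
move=> X0 dX S1 S2 X1 X2 neq12.
have nsub (A C : {set T}) : A \in X -> [disjoint A & C] -> ~~ (A \subset C).
  move=> XA; rewrite -setI_eq0 => /eqP AC0; apply/negP => /setIidPl AC.
  by move: X0; rewrite -AC0 AC XA.
by split; apply: nsub => //; apply: dX => //; rewrite eq_sym.
Qed.

Lemma pairwise_incomparable_set2 (T : finType) (S1 S2 : {set T}) :
  ~~ (S1 \subset S2) -> ~~ (S2 \subset S1) -> pairwise_incomparable [set S1; S2].
Proof.
by move=> n12 n21 A C /set2P[]-> /set2P[]->; rewrite ?eqxx.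
Qed.

Lemma pairwise_incomparable_disjoint (T : finType) (X : {set {set T}}) :
  (forall S1 S2, S1 \in X -> S2 \in X -> ~ nontrivial_intersection S1 S2) ->
  pairwise_incomparable X -> pairwise_disjoint X.
Proof.
move=> triv iX S1 S2 X1 X2 /(iX _ _ X1 X2)[n12 n21].
by rewrite -setI_eq0; apply/negPn/negP => meet; apply: (triv S1 S2).
Qed.

Theorem proposition2p1p8 (T : finType) (Delta B : {set {set T}})
  (hDelta : simplicial_complex Delta) (hB : building_set Delta B)
  (N : {set {set T}}) (hN : N \subset B) :
  nested Delta B N <->
  (forall N' : {set {set T}}, N' \subset N -> 1 < #|N'| ->
     pairwise_disjoint N' -> cover N' \in Delta /\ cover N' \notin B) /\
  (forall S1 S2 : {set T}, S1 \in N -> S2 \in N ->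
     ~ nontrivial_intersection S1 S2).
Proof.
have [_ B0 _ BU] := hB.
split=> [[_ nestN] | [disjN trivN]].
  (* Nestedness restated with unions in place of joins; both conditions are read off from it. *)
  have coverN (X : {set {set T}}) : X \subset N -> 1 < #|X| -> pairwise_incomparable X ->
      cover X \in Delta /\ cover X \notin B.
    move=> XN X1 /(nestN X XN X1)[J [/(is_joinE _ _ hDelta)[cD ->] cB]].
    by split.
  split=> [X XN X1 dX | S1 S2 N1 N2 [n12 n21 meet]].
    apply: coverN => //; apply: pairwise_disjoint_incomparable => //.
    by apply: contra B0 => /(subsetP XN)/(subsetP hN).
  have neq12 : S1 != S2 by apply: contraNneq n12 => ->.
  (* For this pair [coverN] puts the union in [Delta] but outside [B]; since the two sets meet, [BU]
     forces it into [B], a contradiction. *)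
  have [||| UD /negP[]] := coverN [set S1; S2].
  - by apply/subsetP => S /set2P[]->.
  - by rewrite cards2 neq12.
  - exact: pairwise_incomparable_set2.
  have coverU : cover [set S1; S2] = S1 :|: S2.
    by rewrite /cover bigcup_setU !big_set1.
  by rewrite coverU in UD *; apply: BU => //; exact: (subsetP hN).
split=> // X XN X1 iX.
(* Condition (2) makes the incomparable family [X] disjoint, so condition (1) applies and [cover X]
   serves as the join. *)
have [||| cD cB] := disjN X => //.
  apply: pairwise_incomparable_disjoint => // S1 S2 X1' X2'.
  by apply: trivN; exact: (subsetP XN).
by exists (cover X); split=> //; apply/is_joinE.
Qed.
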